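(* There is a linear-time algorithm that, given a connected split graph $G$, decides whether $G$ has a spanning even tree, and, if it does, constructs a spanning even tree of $G$.
   Context: All graphs are finite and simple. A split graph is a graph whose vertex set can be partitioned into a clique and an independent set. A leaf of a tree is a vertex of degree $1$. A tree is even if for every pair of distinct leaves, the number of edges of the unique path between them is even. A spanning even tree of $G$ is a spanning tree of $G$ that is even. Linear time means time $O(|V(G)|+|E(G)|)$. *)

(* Defs.v *)
From mathcomp Require Import all_boot.

Set Implicit Arguments.
Unset Strict Implicit.
Unset Printing Implicit Defensive.

Section Graphs.

Variable T : finType.
Implicit Types (e t : rel T) (x y : T).

Definition simple_graph e := symmetric e /\ irreflexive e.

Definition connected_graph e := 0 < #|T| /\ forall x y, connect e x y.

Definition split_graph e :=
  exists K : {set T},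
    {in K &, forall x y, x != y -> e x y} /\
    {in ~: K &, forall x y, ~~ e x y}.

(* [ucycle] also accepts [:: x; y] for an edge xy, which is not a cycle of the
   graph. *)
Definition acyclic_graph e := forall c : seq T, ucycle e c -> size c < 3.

Definition tree t := [/\ simple_graph t, connected_graph t & acyclic_graph t].

Definition leaf t x := #|[pred y | t x y]| == 1.

(* The path x :: p has [size p] edges. *)
Definition even_tree t :=
  tree t /\
  forall x y, leaf t x -> leaf t y -> x != y ->
  forall p : seq T, path t x p -> uniq (x :: p) -> last x p = y ->
  ~~ odd (size p).

Definition spanning_even_tree e t := subrel t e /\ even_tree t.

End Graphs.

Definition n_edges (n : nat) (e : rel 'I_n) : nat :=
  #|[pred xy : 'I_n * 'I_n | (xy.1 < xy.2) && e xy.1 xy.2]|.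

(* A unit-cost RAM with structured control flow. The store consists of registers
   and of arrays; a program names finitely many of each, so k arrays can be laid
   out in one flat memory by placing cell i of array a at address k * i + a. *)

Inductive operand := Imm of nat | Reg of nat.

Inductive test := Lt of operand & operand | Eq of operand & operand.

Inductive prog :=
| Skip
| Add of nat & operand & operand    (* r := u + v *)
| Sub of nat & operand & operand    (* r := u - v, truncated at 0 *)
| Get of nat & nat & operand        (* r := a[u] *)
| Put of nat & operand & operand    (* a[u] := v *)
| Seq of prog & prog
| If of test & prog & prog
| While of test & prog.

Record state := State { regs : nat -> nat; arrays : nat -> nat -> nat }.

Definition value (s : state) (u : operand) : nat :=
  match u with Imm k => k | Reg r => regs s r end.

Definition holds (s : state) (b : test) : bool :=
  match b with
  | Lt u v => value s u < value s v
  | Eq u v => value s u == value s v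
  end.

Definition set_reg (s : state) (r v : nat) : state :=
  State (fun q => if q == r then v else regs s q) (arrays s).

Definition set_cell (s : state) (a i v : nat) : state :=
  State (regs s)
    (fun b j => if (b == a) && (j == i) then v else arrays s b j).

(* [exec W p s k s']: started in s, p halts in s' after exactly k steps. W is
   the largest value that fits in a machine word; execution is stuck on
   overflow. Only [Add] can overflow: every other instruction writes a value
   that is no larger than one already stored, or than a constant of p. *)
Inductive exec (W : nat) : prog -> state -> nat -> state -> Prop :=
| ExecSkip s : exec W Skip s 1 s
| ExecAdd s r u v : value s u + value s v <= W ->
    exec W (Add r u v) s 1 (set_reg s r (value s u + value s v))
| ExecSub s r u v :
    exec W (Sub r u v) s 1 (set_reg s r (value s u - value s v))
| ExecGet s r a u :
    exec W (Get r a u) s 1 (set_reg s r (arrays s a (value s u)))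
| ExecPut s a u v :
    exec W (Put a u v) s 1 (set_cell s a (value s u) (value s v))
| ExecSeq p q s1 s2 s3 k l :
    exec W p s1 k s2 -> exec W q s2 l s3 -> exec W (Seq p q) s1 (k + l) s3
| ExecIfTrue b p q s s' k : holds s b ->
    exec W p s k s' -> exec W (If b p q) s k.+1 s'
| ExecIfFalse b p q s s' k : ~~ holds s b ->
    exec W q s k s' -> exec W (If b p q) s k.+1 s'
| ExecWhileTrue b p s1 s2 s3 k l : holds s1 b ->
    exec W p s1 k s2 -> exec W (While b p) s2 l s3 ->
    exec W (While b p) s1 (k + l).+1 s3
| ExecWhileFalse b p s : ~~ holds s b -> exec W (While b p) s 1 s.

Lemma exec_det W p s k s' l s'' :
  exec W p s k s' -> exec W p s l s'' -> k = l /\ s' = s''.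
Proof.
move=> H; elim: H l s'' => {p s k s'}; intros;
  match goal with H : exec _ _ _ ?l ?t |- _ = ?l /\ _ = ?t =>
    inversion H; subst; clear H end => //;
  try (exfalso; match goal with
    Hn : is_true (~~ holds ?s ?b), Hp : is_true (holds ?s ?b) |- _ =>
      by rewrite Hp in Hn end);
  repeat match goal with
    IH : forall l t, exec W ?p ?s l t -> _, H : exec W ?p ?s _ _ |- _ =>
      have [? ?] := IH _ _ H; clear IH; subst end; by [].
Qed.

(* The neighbours of each vertex, in an arbitrary order. *)
Definition adjacency_lists (n : nat) (e : rel 'I_n) (adj : 'I_n -> seq 'I_n) :=
  forall x, uniq (adj x) /\ adj x =i [pred y | e x y].

(* Register 0 holds n. Array 1 is the concatenation of the adjacency lists and
   array 0 their n + 1 boundaries: the list of x occupies the cells of array 1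
   from (array 0)[x] included to (array 0)[x + 1] excluded. All the rest is 0. *)
Definition input_state (n : nat) (adj : 'I_n -> seq 'I_n) : state :=
  State
    (fun r => if r == 0 then n else 0)
    (fun a i =>
       if a == 0 then
         nth 0 (mkseq (fun j => \sum_(x < n | x < j) size (adj x)) n.+1) i
       else if a == 1 then
         nth 0 (map val (flatten [seq adj x | x <- enum 'I_n])) i
       else 0).

Definition answer (s : state) : nat := regs s 0.

(* The graph on 'I_n whose n - 1 edges join (array 2)[i] to (array 3)[i]. *)
Definition output_graph (n : nat) (s : state) : rel 'I_n :=
  fun x y => [exists i : 'I_n.-1,
    let u := arrays s 2 i in let v := arrays s 3 i in
    (u == x) && (v == y) || (u == y) && (v == x)].

(* Main.v *)
From mathcomp Require Import all_boot zify.
Require Import Defs.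

(* Let K be a clique whose complement is independent, and let B be a minimal
   nonempty subset of K that dominates the complement of K. Let H be the
   bipartite graph of the edges between B and its complement. By minimality
   every b in B has a neighbour in H whose only neighbour is b, so for n >= 3
   every spanning tree of H has all its leaves outside B and is even. If H is
   disconnected then B = K, since a vertex of K outside B would be joined to
   all of B; every b in K then has a pendant neighbour, which is a leaf of any
   spanning tree, so a tree edge inside K would put two leaves at distance
   three; hence an even spanning tree would be a spanning tree of H.

   In linear time, K is obtained as a set of vertices of high degree, B
   greedily, and a spanning tree of H by breadth-first search. *)

Set Implicit Arguments.
Unset Strict Implicit.
Unset Printing Implicit Defensive.

(** * Reading a split partition off the degrees *)

Section SplitGraphs.

Variables (T : finType) (e : rel T).
Hypotheses (e_sym : symmetric e) (e_irr : irreflexive e).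

Definition split_set (K : {set T}) :=
  {in K &, forall x y, x != y -> e x y} /\ {in ~: K &, forall x y, ~~ e x y}.

(** A clique vertex without neighbours outside can be moved to the independent side; each move
    shrinks the clique, so the process stops. *)
Lemma split_set_with_outer_neighbours K : split_set K ->
  exists K0, split_set K0 /\
    forall k, k \in K0 -> exists2 i, i \notin K0 & e k i.
Proof.
have [m] := ubnP #|K|; elim: m K => // m IH K ltKm [clqK indK].
case: (boolP [forall k in K, exists i, (i \notin K) && e k i]) => [/forall_inP nbrK|].
  by exists K; split=> // k /nbrK /existsP[i /andP[]]; exists i.
case/forall_inPn=> k kK /existsPn no_nbr.
have no_edge i : i \notin K -> ~~ e k i by move=> iK; have := no_nbr i; rewrite iK.
apply: (IH (K :\ k)); first by move: ltKm; rewrite (cardsD1 k K) kK; lia.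
split=> x y.
  by rewrite !inE => /andP[_ xK] /andP[_ yK]; apply: clqK.
rewrite !inE !negb_and !negbK => /predU1P[->|xK] /predU1P[->|yK].
- by rewrite e_irr.
- exact: no_edge.
- by rewrite e_sym no_edge.
- by apply: indK; rewrite inE.
Qed.

Let deg x := #|[pred y | e x y]|.
Let high t := [set x | t <= deg x].

(* Take a split clique K all of whose vertices have a neighbour outside it, so
   that degrees are at least |K| inside and at most |K| outside. The hypotheses
   force t = |K| + 1, and then the set is K, or t = |K|, and then some vertex
   of K has a single neighbour outside; so at most one vertex outside K has
   degree |K|, and it may be added to K. *)
Lemma degree_threshold_split t : split_graph e ->
  t <= #|high t|.+1 -> #|high t.+1| < t -> split_set (high t).
Proof.
move=> [K' splitK'] le_t lt_t.
have [K [[clqK indK] nbrK]] := split_set_with_outer_neighbours splitK'.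
have degK k : k \in K -> #|K| <= deg k.
  move=> kK; have [i iK ki] := nbrK k kK.
  have -> : #|K| = #|i |: K :\ k|.
    by rewrite cardsU1 (cardsD1 k K) kK !inE negb_and iK orbT.
  apply: subset_leq_card; apply/subsetP=> y; rewrite !inE.
  by case/predU1P=> [->//|/andP[yk yK]]; apply: clqK => //; rewrite eq_sym.
have nbrI i y : i \notin K -> e i y -> y \in K.
  by move=> iK; apply: contraLR => yK; apply: indK; rewrite inE.
have subI i : i \notin K -> [set y | e i y] \subset K.
  by move=> iK; apply/subsetP=> y; rewrite inE; apply: nbrI.
have degE x : deg x = #|[set y | e x y]| by rewrite cardsE.
have degI i : i \notin K -> deg i <= #|K|.
  by move=> iK; rewrite degE subset_leq_card ?subI.
have highS a b : a <= b -> high b \subset high a.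
  by move=> ab; apply/subsetP=> x; rewrite !inE; apply: leq_trans.
have K_high : K \subset high #|K| by apply/subsetP=> k kK; rewrite inE degK.
have high_K : high #|K|.+1 \subset K.
  by apply/subsetP=> x; rewrite inE ltnNge; apply: contraR => /degI.
(* If t < |K|, then K lies in [high t.+1], which has fewer than t elements. *)
have geK : #|K| <= t.
  rewrite leqNgt; apply/negP=> ltK.
  have := subset_leq_card (highS _ _ ltK); have := subset_leq_card K_high; lia.
(* If t > |K| + 1, then [high t] lies in K, yet it has at least t - 1 > |K| elements. *)
have leK : t <= #|K|.+1.
  rewrite leqNgt; apply/negP=> ltK.
  have := subset_leq_card (highS _ _ (ltnW ltK)).
  have := subset_leq_card high_K; lia.
have [eq_t|ne_t] := eqVneq t #|K|.+1.
  suff -> : high t = K by [].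
  apply/eqP; rewrite eqEcard eq_t high_K /=.
  by move: le_t; rewrite eq_t.
have {ne_t geK leK}eq_t : t = #|K| by lia.
subst t.
(* [high t.+1] has fewer than |K| elements, so it misses some [k] of K. The degree of [k] is at most
   |K|, of which K itself accounts for |K| - 1: there is room for one outer neighbour only. *)
have [k kK kh] : exists2 k, k \in K & k \notin high #|K|.+1.
  apply/subsetPn; apply/negP=> /subset_leq_card; lia.
have [i0 i0K ki0] := nbrK k kK.
have outer i : i \notin K -> e k i -> i = i0.
  move=> iK ki; apply/eqP; apply: contraR kh => ne.
  rewrite inE; suff -> : #|K|.+1 = #|i |: (i0 |: K :\ k)|.
    apply: subset_leq_card; apply/subsetP=> y; rewrite !inE.
    case/predU1P=> [->//|/predU1P[->//|/andP[yk yK]]].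
    by apply: clqK => //; rewrite eq_sym.
  by rewrite !cardsU1 (cardsD1 k K) kK !inE !negb_or ne !negb_and iK i0K !orbT.
(* An outer vertex has all its neighbours in K, so degree |K| makes it adjacent to all of K, in
   particular to [k]. *)
have full i : i \notin K -> i \in high #|K| -> (forall x, x \in K -> e i x) /\ i = i0.
  move=> iK; rewrite inE => le_i.
  have /eqP eqK : [set y | e i y] == K by rewrite eqEcard subI // -degE.
  have adj x : x \in K -> e i x by rewrite -eqK inE.
  by split=> //; apply: outer => //; rewrite e_sym adj.
split=> x y.
  have [xK|xK] := boolP (x \in K); have [yK|yK] := boolP (y \in K).
  - by move=> _ _; apply: clqK.
  - by move=> _ /(full _ yK)[adj _] _; rewrite e_sym adj.
  - by move=> /(full _ xK)[adj _] _ _; rewrite adj.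
  - by move=> /(full _ xK)[_ ->] /(full _ yK)[_ ->]; rewrite eqxx.
rewrite !in_setC => xh yh; apply: indK; rewrite in_setC.
  exact: contra (subsetP K_high x) xh.
exact: contra (subsetP K_high y) yh.
Qed.

End SplitGraphs.

(** * Even spanning trees and the bipartite graph of crossing edges *)

Section Trees.

Variable T : finType.
Implicit Types (e t : rel T) (B K : {set T}).

(** Descending in rank always ends at [r], which gives connectedness. On a cycle, the vertex of
    largest rank would have two distinct neighbours of smaller rank. *)
Lemma ranked_tree t (rank : T -> nat) (r : T) :
  simple_graph t -> injective rank ->
  (forall x, x != r -> exists2 y, t x y & rank y < rank x) ->
  (forall x y z, t x y -> t x z -> rank y < rank x -> rank z < rank x -> y = z) ->
  tree t.
Proof.
move=> [t_sym t_irr] rank_inj up up_uniq; split=> //.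
  have conn x : connect t x r.
    have [m] := ubnP (rank x); elim: m x => // m IH x lt_x.
    have [->//|/up[y txy lt_y]] := eqVneq x r.
    by apply: connect_trans (connect1 txy) (IH _ _); lia.
  split=> [|x y]; first by apply/card_gt0P; exists r.
  by apply: connect_trans (conn x) _; rewrite (sym_connect_sym t_sym).
move=> c /andP[cyc unq]; rewrite ltnNge; apply/negP=> ge3.
have [x0 x0c] : exists x, x \in c.
  by case: c ge3 {cyc unq} => // x c; exists x; rewrite mem_head.
have [x xc x_max] := @arg_maxnP _ x0 (mem c) rank x0c.
have {}x_max y : y \in c -> rank y <= rank x by apply: x_max.
have [i p def_c] := rot_to xc.
have cyc' : cycle t (x :: p) by rewrite -def_c rot_cycle.
have unq' : uniq (x :: p) by rewrite -def_c rot_uniq.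
have size_p : 2 <= size p by have := size_rot i c; rewrite def_c /=; lia.
have lt_x y : y \in p -> rank y < rank x.
  move=> yp; rewrite ltn_neqAle x_max ?andbT; last first.
    by rewrite -(mem_rot i) def_c inE yp orbT.
  by apply: contraTneq yp => /rank_inj->; case/andP: unq'.
case: p {def_c} size_p cyc' unq' lt_x => // y p; case/lastP: p => // p z _.
rewrite /= rcons_path last_rcons => /and3P[txy _ tzx] /and3P[_ yz _] lt_x.
have eq_yz: y = z.
  apply: (up_uniq x) => //; first by rewrite t_sym.
    by rewrite lt_x ?mem_head.
  by rewrite lt_x // inE mem_rcons mem_head orbT.
by rewrite eq_yz mem_rcons mem_head in yz.
Qed.

Definition crossing e B : rel T := fun x y => e x y && ((x \in B) != (y \in B)).

Lemma crossing_path_parity e B x p : path (crossing e B) x p ->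
  (last x p \in B) = (x \in B) (+) odd (size p).
Proof.
elim: p x => [|y p IH] x /=; first by rewrite addbF.
case/andP=> /andP[_ xy] /IH->; move: xy.
by case: (x \in B); case: (y \in B) => // _; rewrite ?addNb ?addbN //= negbK.
Qed.

Lemma connected_exists_neighbour t x : connected_graph t -> 1 < #|T| ->
  exists y, t x y.
Proof.
move=> [_ conn] gt1.
have [y yx] : exists y, y != x.
  have : 0 < #|[set~ x]| by rewrite cardsC1; lia.
  by case/card_gt0P=> y; rewrite !inE; exists y.
have /connectP[[|z p] /=] := conn x y; first by move=> _ eq_yx; rewrite eq_yx eqxx in yx.
by case/andP=> txz _ _; exists z.
Qed.

Lemma connected_closed_setT t (S : {set T}) x : connected_graph t -> x \in S ->
  (forall y z, y \in S -> t y z -> z \in S) -> S = setT.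
Proof.
move=> [_ conn] xS clS; apply/setP=> y; rewrite in_setT.
have /connectP[p tp ->] := conn x y.
by elim: p x xS tp => //= z p IH x xS /andP[xz]; apply: IH; apply: clS xz.
Qed.

(** Suppose a leaf [b] lies in [B]. The outer vertex [i] private to [b] has [b] as its only tree
    neighbour, and [b] then has only [i], so {b, i} would be the whole vertex set. Hence all leaves
    lie outside [B], and a path that crosses at every edge between two of them is even. *)
Lemma crossing_tree_even e t B : symmetric e ->
  subrel t (crossing e B) -> tree t -> 2 < #|T| ->
  (forall b, b \in B -> exists2 i, i \notin B & {in B, forall z, e i z -> z = b}) ->
  even_tree t.
Proof.
move=> e_sym t_cross tree_t gt2 privB; split=> // .
have [[t_sym t_irr] t_conn _] := tree_t.
have leafB b : leaf t b -> b \notin B.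
  move=> leaf_b; apply/negP=> bB; have [i iB priv_i] := privB b bB.
  have nbr_i y : t i y -> y = b.
    move=> tiy; have /andP[eiy] := t_cross _ _ tiy.
    by rewrite (negPf iB) => yB; apply: priv_i eiy; move: yB; case: (y \in B).
  have [y tiy] := connected_exists_neighbour i t_conn (ltnW gt2).
  have tbi : t b i by rewrite t_sym -(nbr_i y tiy).
  have nbr_b z : t b z -> z = i.
    move: leaf_b => /card1P[w eq_w] tbz.
    by have := eq_w z; have := eq_w i; rewrite !inE tbz tbi => /esym/eqP-> /esym/eqP->.
  have eqT : [set b; i] = setT.
    apply: (connected_closed_setT t_conn (set21 b i)) => u v.
    by rewrite !inE => /orP[] /eqP-> => [/nbr_b->|/nbr_i->]; rewrite eqxx ?orbT.
  have := cards2 b i; rewrite eqT cardsT; case: (b != i); lia.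
move=> x y /leafB xB /leafB yB _ p tp _ last_p.
have := crossing_path_parity (sub_path t_cross tp).
by rewrite last_p (negPf xB) (negPf yB) /= => <-.
Qed.

Lemma leaf_of_pendant e t x k : subrel t e -> connected_graph t -> 1 < #|T| ->
  (forall y, e x y -> y = k) -> leaf t x /\ t x k.
Proof.
move=> t_e conn_t gt1 pend; have [y txy] := connected_exists_neighbour x conn_t gt1.
have txk : t x k by rewrite -(pend y (t_e _ _ txy)).
split=> //; apply/card1P; exists k => z; rewrite !inE.
by apply/idP/eqP=> [/t_e/pend|->].
Qed.

(* If B is a proper subset of K then the crossing edges connect everything, and
   otherwise every vertex of B carries a pendant vertex, which is a leaf of
   every spanning tree: a tree edge inside B would then put two leaves at
   distance three. *)
Lemma no_spanning_even_tree e K B :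
  simple_graph e -> split_set e K -> 1 < #|T| -> B \subset K -> B != set0 ->
  (forall i, i \notin K -> exists2 b, b \in B & e i b) ->
  (forall b, b \in B -> exists2 i, i \notin B & {in B, forall z, e i z -> z = b}) ->
  (exists x y, ~~ connect (crossing e B) x y) ->
  ~ exists t, spanning_even_tree e t.
Proof.
move=> [e_sym e_irr] [clqK indK] gt1 BK /set0Pn[b0 b0B] dom priv [x0 [y0 nconn]].
have c_sym : symmetric (crossing e B).
  by move=> x y; rewrite /crossing e_sym eq_sym.
have KB : K \subset B.
  apply/subsetP=> a aK; apply: contraR nconn => aB.
  have toB b : b \in B -> crossing e B a b.
    move=> bB; rewrite /crossing bB (negPf aB) andbT clqK // ?(subsetP BK) //.
    by apply: contraNneq aB => ->.
  have conn_a x : connect (crossing e B) a x.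
    have [xB|xB] := boolP (x \in B); first exact/connect1/toB.
    have [xK|/dom[b bB exb]] := boolP (x \in K).
      apply: connect_trans (connect1 (toB _ b0B)) (connect1 _).
      rewrite /crossing b0B (negPf xB) andbT clqK // ?(subsetP BK) //.
      by apply: contraNneq xB => <-.
    apply: connect_trans (connect1 (toB _ bB)) (connect1 _).
    by rewrite /crossing bB (negPf xB) e_sym exb.
  by apply: connect_trans (conn_a y0); rewrite (sym_connect_sym c_sym).
have eqBK : B = K by apply/eqP; rewrite eqEsubset BK.
subst B.
move=> [t [t_e [[[t_sym _] t_conn _] even_t]]].
have pend b : b \in K -> exists2 i, i \notin K & leaf t i /\ t i b.
  move=> bK; have [i iK priv_i] := priv b bK; exists i => //.
  apply: (leaf_of_pendant t_e t_conn gt1) => y eiy; apply: priv_i => //.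
  by apply: contraTT eiy => yK; apply: indK; rewrite inE.
have t_cross : subrel t (crossing e K).
  move=> x y txy; rewrite /crossing t_e //=.
  have [xK|xK] := boolP (x \in K); have [yK|yK] := boolP (y \in K) => //; last first.
    by have := indK x y; rewrite !inE t_e // xK yK => /(_ isT isT).
  have [i iK [leaf_i tix]] := pend x xK; have [j jK [leaf_j tjy]] := pend y yK.
  have xy : x != y by apply: contraTneq txy => ->; apply: contraTN isT => /t_e; rewrite e_irr.
  have ij : i != j.
    apply: contra_neq xy => eq_ij; subst j.
    move: leaf_i => /card1P[w eq_w].
    by have := eq_w x; have := eq_w y; rewrite !inE tix tjy => /esym/eqP-> /esym/eqP->.
  have ne u v : u \notin K -> v \in K -> u != v by move=> uK vK; apply: contraNneq uK => ->.
  have unq : uniq [:: i; x; y; j].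
    by rewrite /= !inE !negb_or xy ij [x == j]eq_sym [y == j]eq_sym !ne.
  have tp : path t i [:: x; y; j] by rewrite /= tix txy t_sym tjy.
  by have := even_t i j leaf_i leaf_j ij _ tp unq erefl.
move/negP: nconn; apply; apply: connect_sub (t_conn.2 x0 y0) => u v tuv.
exact/connect1/t_cross.
Qed.

(** Both vertices are leaves, at distance one. *)
Lemma no_even_tree_on_edge t : #|T| = 2 -> ~ even_tree t.
Proof.
move=> card2 [[[t_sym t_irr] t_conn _] even_t].
have [x _] : exists x, x \in T by apply/card_gt0P; rewrite card2.
have [y txy] := connected_exists_neighbour x t_conn (eq_leq (esym card2)).
have xy : x != y by apply: contraTneq txy => ->; rewrite t_irr.
have eqT : [set x; y] = setT.
  by apply/eqP; rewrite eqEcard subsetT cardsT cards2 xy card2.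
have mem z : (z == x) || (z == y) by have := in_setT z; rewrite -eqT !inE.
have leaf_x : leaf t x.
  apply/card1P; exists y => z; rewrite !inE; case/orP: (mem z) => /eqP->.
    by rewrite t_irr (negPf xy).
  by rewrite txy eqxx.
have leaf_y : leaf t y.
  apply/card1P; exists x => z; rewrite !inE; case/orP: (mem z) => /eqP->.
    by rewrite t_sym txy eqxx.
  by rewrite t_irr eq_sym (negPf xy).
have := even_t x y leaf_x leaf_y xy [:: y].
by rewrite /= txy inE xy => /(_ isT isT erefl).
Qed.

Lemma trivial_even_tree t : #|T| = 1 -> simple_graph t -> even_tree t.
Proof.
move=> card1 simp; have eqT (x y : T) : x = y.
  by have [z eqz] := card1P (introT eqP card1); have := eqz x; have := eqz y;
     rewrite !inE => /esym/eqP-> /esym/eqP->.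
split; last by move=> x y _ _; rewrite (eqT x y) eqxx.
split=> //; first by split=> [|x y]; rewrite ?card1 // (eqT x y).
move=> c /andP[_ unq]; rewrite -(card_uniqP unq).
by apply: leq_ltn_trans (max_card _) _; rewrite card1.
Qed.

End Trees.

(** * Program logic *)

Section ProgramLogic.

Variable W : nat.
Implicit Types (p q body : prog) (Q : nat -> state -> Prop) (k : nat) (s : state).

(* [wp p Q k s]: with k steps of credit p halts, and Q holds of the credit left
   over and of the final state. *)
Definition wp p Q k s :=
  exists t s', [/\ exec W p s t s', t <= k & Q (k - t) s'].

Lemma wp_skip Q k s : 0 < k -> Q k.-1 s -> wp Skip Q k s.
Proof. by move=> k0 Qs; exists 1, s; rewrite subn1; split=> //; constructor. Qed.

Lemma wp_add r u v Q k s : 0 < k -> value s u + value s v <= W ->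
  Q k.-1 (set_reg s r (value s u + value s v)) -> wp (Add r u v) Q k s.
Proof. by move=> k0 uv Qs; eexists 1, _; rewrite subn1; split; [constructor|..]. Qed.

Lemma wp_sub r u v Q k s : 0 < k ->
  Q k.-1 (set_reg s r (value s u - value s v)) -> wp (Sub r u v) Q k s.
Proof. by move=> k0 Qs; eexists 1, _; rewrite subn1; split; [constructor|..]. Qed.

Lemma wp_get r a u Q k s : 0 < k ->
  Q k.-1 (set_reg s r (arrays s a (value s u))) -> wp (Get r a u) Q k s.
Proof. by move=> k0 Qs; eexists 1, _; rewrite subn1; split; [constructor|..]. Qed.

Lemma wp_put a u v Q k s : 0 < k ->
  Q k.-1 (set_cell s a (value s u) (value s v)) -> wp (Put a u v) Q k s.
Proof. by move=> k0 Qs; eexists 1, _; rewrite subn1; split; [constructor|..]. Qed.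

Lemma wp_seq p q Q k s : wp p (wp q Q) k s -> wp (Seq p q) Q k s.
Proof.
move=> [t [s1 [e1 le1 [u [s2 [e2 le2 Q2]]]]]].
by exists (t + u), s2; rewrite subnDA; split=> //; [econstructor; eassumption | lia].
Qed.

Lemma wp_if b p q Q k s : 0 < k ->
  (holds s b -> wp p Q k.-1 s) -> (~~ holds s b -> wp q Q k.-1 s) ->
  wp (If b p q) Q k s.
Proof.
move=> k0 wp_p wp_q; have [hb|hb] := boolP (holds s b).
  have [t [s' [ex le_t Qs]]] := wp_p hb; exists t.+1, s'.
  by split; [apply: ExecIfTrue | lia | rewrite (_ : k - _ = k.-1 - t) //; lia].
have [t [s' [ex le_t Qs]]] := wp_q hb; exists t.+1, s'.
by split; [apply: ExecIfFalse | lia | rewrite (_ : k - _ = k.-1 - t) //; lia].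
Qed.

(* The credit strictly decreases, so it serves as the termination measure. *)
Lemma wp_while (J : nat -> state -> Prop) b p Q k s :
  J k s ->
  (forall k s, J k s -> 0 < k /\
     (if holds s b then wp p J k.-1 s else Q k.-1 s)) ->
  wp (While b p) Q k s.
Proof.
move=> Js step; have [m] := ubnP k; elim: m k s Js => // m IH k s Js lt_k.
have [k0] := step k s Js; case: ifP => hb.
  case=> [t [s1 [e1 le1 /IH J1]]].
  have [|u [s2 [e2 le2 Q2]]] := J1; first lia.
  exists (t + u).+1, s2; split; [exact: ExecWhileTrue e1 e2 | lia |].
  by rewrite (_ : k - _ = k.-1 - t - u) //; lia.
by move=> Qs; exists 1, s; rewrite subn1; split=> //; apply: ExecWhileFalse; rewrite hb.
Qed.

(** Lets a phase be verified with its own budget [c] and then run inside a larger credit, of which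
    at least k - c remains. *)
Lemma wp_budget p (P : state -> Prop) c Q k s : wp p (fun _ => P) c s -> c <= k ->
  (forall k' s', k <= k' + c -> P s' -> Q k' s') -> wp p Q k s.
Proof.
move=> [t [s' [ex le_t Ps]]] le_c PQ; exists t, s'; split=> //; first lia.
by apply: PQ => //; lia.
Qed.

End ProgramLogic.

Ltac wp_step :=
  repeat apply: wp_seq;
  match goal with
  | |- wp _ Skip _ _ _ => apply: wp_skip
  | |- wp _ (Add _ _ _) _ _ _ => apply: wp_add
  | |- wp _ (Sub _ _ _) _ _ _ => apply: wp_sub
  | |- wp _ (Get _ _ _) _ _ _ => apply: wp_get
  | |- wp _ (Put _ _ _) _ _ _ => apply: wp_put
  | |- wp _ (If _ _ _) _ _ _ => apply: wp_if
  end.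

(** * Loops over the vertices and over the neighbours of a vertex *)

Definition for_vertices (body : prog) : prog :=
  Seq (Add 1 (Imm 0) (Imm 0))
      (While (Lt (Reg 1) (Reg 0)) (Seq body (Add 1 (Reg 1) (Imm 1)))).

(* Register 7 runs through the neighbours of the vertex in register r. *)
Definition for_neighbours (r : nat) (body : prog) : prog :=
  Seq (Get 5 0 (Reg r))
 (Seq (Add 6 (Reg r) (Imm 1))
 (Seq (Get 6 0 (Reg 6))
      (While (Lt (Reg 5) (Reg 6))
         (Seq (Get 7 1 (Reg 5)) (Seq body (Add 5 (Reg 5) (Imm 1))))))).

(** The degree is the difference of two consecutive boundaries in array 0; register 8 is scratch. *)
Definition get_degree (r : nat) : prog :=
  Seq (Get 8 0 (Reg 1))
 (Seq (Add r (Reg 1) (Imm 1))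
 (Seq (Get r 0 (Reg r)) (Sub r (Reg r) (Reg 8)))).

(** The graph with vertices as natural numbers: [N] gives the neighbour lists, [off] and [nbr] are
    the contents of arrays 0 and 1. Thus [off n] is the sum of all degrees. *)
Record graph_input (n : nat) (N : nat -> seq nat) (off nbr : nat -> nat) : Prop :=
  GraphInput {
    off0 : off 0 = 0;
    offS : forall x, x < n -> off x.+1 = off x + size (N x);
    nbrE : forall x i, x < n -> i < size (N x) -> nbr (off x + i) = nth 0 (N x) i;
    N_lt : forall x y, x < n -> y \in N x -> y < n;
    N_uniq : forall x, x < n -> uniq (N x);
    N_sym : forall x y, x < n -> y < n -> (y \in N x) = (x \in N y);
    N_irr : forall x, x < n -> x \notin N x
  }.

Section Phases.

Variables (W n : nat) (N : nat -> seq nat) (off nbr : nat -> nat).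
Hypothesis inp : graph_input n N off nbr.
Hypothesis W_big : n + off n + 10 <= W.

Local Notation deg x := (size (N x)).
Local Notation wp := (wp W).

Definition input_ok (s : state) :=
  [/\ regs s 0 = n, arrays s 0 = off & arrays s 1 = nbr].

Lemma off_mono x y : x <= y <= n -> off x <= off y.
Proof.
move=> /andP[]; elim: y => [|y IH]; first by case: x.
rewrite leq_eqVlt => /predU1P[->//|ltxy] lt_y.
by rewrite (offS inp) //; have := IH ltxy (ltnW lt_y); lia.
Qed.

Lemma deg_lt x : x < n -> deg x < n.
Proof.
move=> ltx; have sub : {subset x :: N x <= iota 0 n}.
  by move=> y; rewrite inE mem_iota => /predU1P[->//|/(N_lt inp ltx)].
have := uniq_leq_size _ sub.
by rewrite /= (N_irr inp) // (N_uniq inp) // size_iota; apply.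
Qed.

(** A body of cost a + b * deg x sums to a * n + b * off n. Each round adds a test and an increment;
    the remaining 2 pays for the initialisation and the last test. *)
Lemma wp_for_vertices body a b (J : nat -> state -> Prop) s (P : state -> Prop) :
  regs s 0 = n ->
  (forall x s v, J x s -> J x (set_reg s 1 v)) ->
  J 0 s ->
  (forall x s, x < n -> regs s 0 = n -> regs s 1 = x -> J x s ->
     wp body (fun _ s' => [/\ regs s' 0 = n, regs s' 1 = x & J x.+1 s'])
        (a + b * deg x) s) ->
  (forall s', regs s' 0 = n -> J n s' -> P s') ->
  wp (for_vertices body) (fun _ => P) (2 + a.+2 * n + b * off n) s.
Proof.
move=> s0 stab J0 step JP.
repeat wp_step; rewrite /=; [lia | lia |].
pose I k s := exists x, [/\ x <= n, regs s 0 = n, regs s 1 = x, J x s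
  & 1 + a.+2 * (n - x) + b * (off n - off x) <= k].
apply: (wp_while (J := I)).
  exists 0; rewrite /= (off0 inp) !subn0; split=> //.
  exact: stab.
move=> {J0 s0}k {}s [x [le_x s0 s1 Js le_k]]; split; first by case: k le_k.
rewrite /= s0 s1; case: ltnP => [lt_x|ge_x]; last first.
  by apply: JP => //; rewrite (_ : n = x) //; lia.
have offx := offS inp lt_x.
have le_off : off x.+1 <= off n by apply: off_mono; rewrite lt_x leqnn.
(* Naming the remaining cost hides its nonlinear products from [lia]. *)
have [rest def_rest] : exists m, m = 1 + a.+2 * (n - x.+1) + b * (off n - off x.+1).
  by eexists.
have cost : a + b * deg x + (1 + rest) < k.
  apply: leq_trans le_k; rewrite def_rest.
  have -> : n - x = (n - x.+1).+1 by lia.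
  have -> : off n - off x = deg x + (off n - off x.+1) by lia.
  by rewrite mulnS mulnDr; lia.
apply: wp_seq; apply: wp_budget (step x s lt_x s0 s1 Js) _ _; first by lia.
move=> k' s' le_k' [s'0 s'1 Js'].
wp_step; rewrite /=; [lia | rewrite s'1; lia |].
exists x.+1; split; rewrite /= ?s'1 ?addn1 // -?def_rest; last by lia.
exact: stab.
Qed.

(** The invariant is indexed by the part of the list already visited. Each neighbour costs [c] plus
    the test, the fetch and the increment; 4 covers the three set-up instructions and the last test.
    Register 5 is overwritten before [r] is read again, hence [r != 5]. *)
Lemma wp_for_neighbours r body c (J : seq nat -> state -> Prop) Q k s x :
  x < n -> regs s r = x -> r != 5 ->
  (forall l s v i, i \in [:: 5; 6; 7] -> J l s -> J l (set_reg s i v)) ->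
  (forall l s, J l s -> arrays s 0 = off /\ arrays s 1 = nbr) ->
  J [::] s ->
  (forall l1 y l2 s, N x = l1 ++ y :: l2 -> J l1 s -> regs s 7 = y ->
     wp body (fun _ s' => [/\ regs s' 5 = regs s 5, regs s' 6 = regs s 6
                            & J (rcons l1 y) s']) c s) ->
  4 + (c + 3) * deg x <= k ->
  (forall k' s', k <= k' + (4 + (c + 3) * deg x) -> J (N x) s' -> Q k' s') ->
  wp (for_neighbours r body) Q k s.
Proof.
move=> ltx sr r5 stab frame J0 step le_k JQ.
have [a0 a1] := frame _ _ J0; have offx := offS inp ltx.
have le_off : off x.+1 <= off n by apply: off_mono; rewrite ltx leqnn.
have k4 : 4 <= k by apply: leq_trans le_k; exact: leq_addr.
wp_step; rewrite /=; first lia.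
wp_step; rewrite /=; [lia | by rewrite (negPf r5) sr; lia |].
wp_step; rewrite /=; first lia.
rewrite (negPf r5) sr a0 addn1.
set s3 := set_reg _ 6 _.
pose I j s' := exists l1 l2, [/\ N x = l1 ++ l2, regs s' 5 = off x + size l1,
  regs s' 6 = off x.+1, J l1 s' & k <= j + (3 + (c + 3) * size l1)].
apply: (wp_while (J := I)).
  exists [::], (N x); rewrite /= addn0; split=> //; last by lia.
  by do 3 apply: (stab) => //.
move=> {J0 a0 a1 s3 sr}j {}s [l1 [l2 [def_N s5 s6 Js le_j]]].
have [a0 a1] := frame _ _ Js.
have size_N : deg x = size l1 + size l2 by rewrite def_N size_cat.
have cost : (c + 3) * deg x = (c + 3) * size l1 + (c + 3) * size l2.
  by rewrite size_N mulnDr.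
split; first lia.
rewrite /= s5 s6; case: ltnP => [lt_i|ge_i]; last first.
  have l20 : l2 = [::] by case: l2 {def_N cost} size_N => //= y l2; lia.
  by apply: JQ; [subst l2; rewrite /= in cost; lia | rewrite def_N l20 cats0].
case: l2 def_N size_N cost => [|y l2] def_N size_N; first by rewrite /= in size_N; lia.
rewrite /= mulnS => cost.
wp_step; rewrite /=; first lia.
have -> : arrays s 1 (regs s 5) = y.
  by rewrite a1 s5 (nbrE inp) // ?size_N /=; [rewrite def_N nth_cat ltnn subnn | lia].
set s4 := set_reg _ _ _.
have Js4 : J l1 s4 by apply: stab.
apply: wp_seq; apply: wp_budget (step _ _ _ s4 def_N Js4 erefl) _ _; first lia.
move=> j' s' le_j' [s'5 s'6 Js'].
have size_i : size l1 < size (N x) by rewrite size_N /=; lia.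
wp_step; rewrite /=; first lia; first by rewrite s'5 /= s5; lia.
exists (rcons l1 y), l2; rewrite /= s'5 s'6 /= s5 size_rcons cat_rcons; split=> //; first lia.
  exact: stab.
by lia.
Qed.

Lemma wp_get_degree r Q k s : r \notin [:: 0; 1; 8] -> input_ok s ->
  regs s 1 < n -> 4 <= k ->
  (forall k', k' = k - 4 -> Q k' (set_reg (set_reg (set_reg (set_reg s 8 (off (regs s 1)))
     r (regs s 1).+1) r (off (regs s 1).+1)) r (deg (regs s 1)))) ->
  wp (get_degree r) Q k s.
Proof.
rewrite !inE !negb_or => /and3P[r0 r1 r8] [s0 a0 a1] lt1 le_k Qs.
wp_step; rewrite /=; first lia.
wp_step; rewrite /=; [lia | lia |].
do 2 (wp_step; rewrite /=; first lia).
rewrite a0 !eqxx eq_sym (negPf r8) addn1 (offS inp) // addKn.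
have := Qs _ erefl; rewrite (offS inp) // (_ : _.-1 = k - 4) //; lia.
Qed.


(** * Counting the degrees and choosing the threshold *)

(* Registers: 0 holds n, 1 the current vertex, 3 the number of dominators plus
   one, 9 the degree threshold; in [bfs], 1 and 2 are the head and the tail of
   the queue and 3 the current vertex. Arrays: 4 counts
   the vertices of each degree, 5 is the indicator of the dominators, 6[y] is
   the number of dominators adjacent to y if y is outside the clique (and at
   least 2 otherwise), 7 marks the vertices reached, 8 is the queue. *)
Definition count_degrees : prog :=
  for_vertices
    (Seq (get_degree 2)
    (Seq (Get 3 4 (Reg 2)) (Seq (Add 3 (Reg 3) (Imm 1)) (Put 4 (Reg 2) (Reg 3))))).

Definition degree_count m d := count (fun v => deg v == d) (iota 0 m).

Arguments degree_count : simpl never.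

Lemma degree_countS m d : degree_count m.+1 d = degree_count m d + (deg m == d).
Proof. by rewrite /degree_count -addn1 iotaD count_cat /= addn0. Qed.

Lemma wp_count_degrees s : input_ok s ->
  (forall a i, 1 < a -> arrays s a i = 0) ->
  wp count_degrees (fun _ s' => [/\ input_ok s', arrays s' 7 =1 fun=> 0
    & forall d, arrays s' 4 d = degree_count n d])
    (2 + 9 * n) s.
Proof.
move=> [s0 a0 a1] zero.
rewrite (_ : 2 + 9 * n = 2 + 7.+2 * n + 0 * off n); last by rewrite mul0n addn0.
apply: (@wp_for_vertices _ _ _ (fun x s' => [/\ arrays s' 0 = off, arrays s' 1 = nbr,
  arrays s' 7 =1 fun=> 0 & forall d, arrays s' 4 d = degree_count x d])) => //.
- by split=> // i; rewrite zero.
- move=> x {a0 a1 zero s0}s ltx s0 s1 [a0 a1 a7 a4]; apply: wp_seq.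
  apply: wp_get_degree => //; first by rewrite s1.
  move=> k' ->; rewrite s1 mul0n /=.
  wp_step => //=; wp_step => //=.
    rewrite a4 addn1; apply: leq_ltn_trans (count_size _ _) _.
    by rewrite size_iota; lia.
  wp_step => //=; split=> //; split=> // d.
  rewrite a4 degree_countS a4 eq_sym.
  by case: eqP => [->|]; rewrite ?addn0.
- by move=> s' s'0 [].
Qed.

Definition high t := count (fun v => t <= deg v) (iota 0 n).

Lemma highE t : high t = high t.+1 + degree_count n t.
Proof.
rewrite /high /degree_count; elim: (iota 0 n) => //= v l ->.
by case: ltngtP; lia.
Qed.

Definition find_threshold : prog :=
  Seq (Add 9 (Reg 0) (Imm 0))
 (Seq (Add 3 (Imm 1) (Imm 0))
      (While (Lt (Reg 3) (Reg 9))
         (Seq (Sub 9 (Reg 9) (Imm 1)) (Seq (Get 2 4 (Reg 9)) (Add 3 (Reg 3) (Reg 2)))))).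

(** The threshold descends from n while |high t| + 1 < t. The failed test gives the first
    inequality, and the successful test one level higher gives the second: these are the hypotheses
    of [degree_threshold_split]. *)
Lemma wp_find_threshold s : 1 < n -> input_ok s -> arrays s 7 =1 (fun=> 0) ->
  (forall d, arrays s 4 d = degree_count n d) ->
  wp find_threshold (fun _ s' => exists t,
    [/\ input_ok s', arrays s' 7 =1 (fun=> 0), regs s' 9 = t, regs s' 3 = (high t).+1
      & t <= (high t).+1 /\ high t.+1 < t]) (3 + 4 * n) s.
Proof.
move=> gt1 [s0 a0 a1] a7 a4.
have high_n : high n = 0.
  apply/eqP; rewrite -leqn0 leqNgt -has_count; apply/hasPn=> v.
  by rewrite mem_iota -ltnNge => /andP[_ /deg_lt].
wp_step => //=; first by lia.
wp_step => //=; first by lia.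
pose J k s := exists t, [/\ [/\ input_ok s, arrays s 7 =1 (fun=> 0)
    & forall d, arrays s 4 d = degree_count n d],
  regs s 9 = t, regs s 3 = (high t).+1, t <= n & [/\ t = n \/ high t.+1 < t & 1 + 4 * t <= k]].
apply: (wp_while (J := J)).
  exists n; rewrite /= addn0 s0 high_n addn0; split=> //; split; [by left | by lia].
move=> k {a0 a1 a4 a7 s0}s [t [[[s0 a0 a1] a7 a4] s9 s3 le_t [last_t le_k]]].
split; first lia; rewrite /= s9 s3; case: ltnP => [lt_t|ge_t]; last first.
  (* Only at t = n has no earlier test succeeded; stopping there would give n <= 1, since [high n]
     is 0. *)
  exists t; split=> //; split=> //; case: last_t => // eq_t.
  by move: ge_t; rewrite eq_t high_n; lia.
wp_step => /=; first lia.
wp_step => /=; first lia.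
have high_le u : high u <= n by rewrite -[leqRHS](size_iota 0) count_size.
have eq_t : t = (t - 1).+1 by lia.
have high_t := highE (t - 1); rewrite -eq_t in high_t.
wp_step => /=; first lia.
  by rewrite s3 s9 a4 addSn -high_t; have := high_le (t - 1); lia.
exists (t - 1); rewrite /= s3 s9 a4 addSn -high_t -eq_t; split=> //; first lia.
by split; [right | ]; lia.
Qed.

(** * The dominators and their greedy removal *)

Definition init_dominators : prog :=
  for_vertices
    (Seq (get_degree 2)
    (If (Lt (Reg 2) (Reg 9))
        (Seq (Put 5 (Reg 1) (Imm 0)) (Put 6 (Reg 1) (Reg 2)))
        (Seq (Put 5 (Reg 1) (Imm 1))
        (Seq (Add 2 (Reg 2) (Imm 2)) (Put 6 (Reg 1) (Reg 2)))))).

(** The extra 2 on the clique lets [greedy] compare every counter with 2 without asking on which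
    side the vertex lies. *)
Lemma wp_init_dominators s t : input_ok s -> arrays s 7 =1 (fun=> 0) ->
  regs s 9 = t ->
  wp init_dominators (fun _ s' => [/\ input_ok s', arrays s' 7 =1 (fun=> 0),
    regs s' 3 = regs s 3, forall z, z < n -> arrays s' 5 z = (t <= deg z)
    & forall z, z < n -> arrays s' 6 z = deg z + 2 * (t <= deg z)]) (2 + 10 * n) s.
Proof.
move=> [s0 a0 a1] a7 s9.
rewrite (_ : 2 + 10 * n = 2 + 8.+2 * n + 0 * off n); last by rewrite mul0n addn0.
apply: (@wp_for_vertices _ _ _ (fun x s' => [/\ [/\ arrays s' 0 = off, arrays s' 1 = nbr
   & arrays s' 7 =1 fun=> 0], regs s' 9 = t, regs s' 3 = regs s 3,
   forall z, z < x -> arrays s' 5 z = (t <= deg z)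
 & forall z, z < x -> arrays s' 6 z = deg z + 2 * (t <= deg z)])) => //.
- move=> x s' ltx s'0 s'1 [[b0 b1 b7] s'9 s'3 b5 b6]; apply: wp_seq.
  apply: wp_get_degree => //; first by rewrite s'1.
  move=> k' ->; rewrite s'1 mul0n /=.
  wp_step => //=; rewrite s'9 => lt_t.
    wp_step => //=; wp_step => //=; split=> //; split=> // z.
      rewrite s'1 ltnS leq_eqVlt.
      by case: eqP => /= [-> _ | _ /b5 //]; rewrite leqNgt lt_t.
    rewrite s'1 ltnS leq_eqVlt.
    by case: eqP => /= [-> _ | _ /b6 //]; rewrite leqNgt lt_t addn0.
  rewrite -leqNgt in lt_t.
  wp_step => //=; wp_step => //=; first by have := deg_lt ltx; lia.
  wp_step => //=; split=> //; split=> // z.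
    by rewrite s'1 ltnS leq_eqVlt; case: eqP => /= [-> _ | _ /b5 //]; rewrite lt_t.
  by rewrite s'1 ltnS leq_eqVlt; case: eqP => /= [-> _ | _ /b6 //]; rewrite lt_t.
- by move=> s' s'0 [[b0 b1 b7] s'9 s'3 b5 b6].
Qed.


(** The two reasons for keeping [b]: some vertex outside [K] has no other dominator, or [b] is the
    last dominator. *)
Definition private (K S : pred nat) b :=
  (exists y, [/\ y < n, ~~ K y & forall z, z \in N y -> S z -> z = b]) \/
  (forall z, z < n -> K z -> S z -> z = b).

(* S consists of the vertices that have not been dropped: initially everything,
   and vertices of K are dropped while K and S still dominate the complement
   of K. *)
Record greedy_inv (K S : pred nat) (x : nat) : Prop := GreedyInv {
  greedy_dropped : forall z, ~~ S z -> z < x /\ K z;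
  greedy_nonempty : 0 < count (predI K S) (iota 0 n);
  greedy_dominating : forall y, y < n -> ~~ K y -> has S (N y);
  greedy_private : forall b, b < x -> K b -> S b -> private K S b
}.

Definition drop_vertex (S : pred nat) x : pred nat := [pred z | S z && (z != x)].

Lemma count_drop_vertex (S : pred nat) x l : uniq l -> S x ->
  count (drop_vertex S x) l = count S l - (x \in l).
Proof.
move=> unq Sx; rewrite -(count_uniq_mem _ unq).
suff <- : count (drop_vertex S x) l + count_mem x l = count S l by rewrite addnK.
elim: l {unq} => //= y l <-.
rewrite [drop_vertex S x y]/(S y && (y != x)).
by have [->|_] := eqVneq y x; rewrite ?Sx ?andbT /=; lia.
Qed.

Definition removable (K S : pred nat) x :=
  (2 <= count (predI K S) (iota 0 n)) &&
  all (fun y => 2 <= count S (N y) + 2 * K y) (N x).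

Section Greedy.

Variables (K S : pred nat) (x : nat).
Hypotheses (inv : greedy_inv K S x) (ltx : x < n).

Lemma greedy_unprocessed : S x.
Proof. by apply: contraT => /(greedy_dropped inv)[]; rewrite ltnn. Qed.

Lemma greedy_skip : ~~ K x -> greedy_inv K S x.+1.
Proof.
case: inv => dropped ne dom priv Kx; split=> // [z /dropped[ltz Kz]|b].
  by split=> //; apply: leqW.
by rewrite ltnS leq_eqVlt => /predU1P[->|/priv//]; rewrite (negPf Kx).
Qed.

Lemma count_le1_unique (P : pred nat) l a b : uniq l -> count P l <= 1 ->
  a \in l -> b \in l -> P a -> P b -> a = b.
Proof.
move=> unq le1 al bl Pa Pb; apply/eqP; apply: contraLR le1 => ab.
rewrite -ltnNge -size_filter; apply: (uniq_leq_size (s1 := [:: a; b])).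
  by rewrite /= inE ab.
by move=> z; rewrite !inE mem_filter => /orP[] /eqP->; rewrite ?Pa ?Pb.
Qed.

(** Each way for [removable] to fail leaves a count of at most one, and [x] is already counted; this
    yields one alternative of [private]. *)
Lemma greedy_keep : K x -> ~~ removable K S x -> greedy_inv K S x.+1.
Proof.
move=> Kx nrem; have Sx := greedy_unprocessed.
case: inv => dropped ne dom priv; split=> // [z /dropped[ltz Kz]|b].
  by split=> //; apply: leqW.
rewrite ltnS leq_eqVlt => /predU1P[->|/priv//] _ _.
move: nrem; rewrite negb_and -leqNgt => /orP[le1|/allPn[y yNx]].
  right=> z ltz Kz Sz.
  apply: (count_le1_unique (iota_uniq 0 n) le1); rewrite ?mem_iota //=.
    by rewrite Kz.
  by rewrite Kx.
rewrite -leqNgt => le1; left; exists y.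
have lty := N_lt inp ltx yNx.
have Ky : ~~ K y by case: (K y) le1 => //=; lia.
have le1' : count S (N y) <= 1 by lia.
split=> // z zNy Sz; apply: (count_le1_unique (N_uniq inp lty) le1' zNy) => //.
by rewrite (N_sym inp).
Qed.

(** Shrinking [S] only weakens the conditions in [private], so earlier witnesses survive, while
    [removable] leaves every outer neighbour of [x] another dominator. *)
Lemma greedy_drop : K x -> removable K S x -> greedy_inv K (drop_vertex S x) x.+1.
Proof.
move=> Kx /andP[ge2 allN]; have Sx := greedy_unprocessed.
case: inv => dropped ne dom priv; split.
- move=> z; rewrite /= negb_and negbK => /orP[/dropped[ltz Kz]|/eqP-> //].
  by split=> //; apply: leqW.
- have -> : count (predI K (drop_vertex S x)) (iota 0 n)
      = count (drop_vertex (predI K S) x) (iota 0 n).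
    by apply: eq_count => z /=; rewrite andbA.
  rewrite count_drop_vertex ?iota_uniq ?mem_iota //=; last by rewrite Kx.
  by case: (x < _); lia.
- move=> y lty Ky; rewrite has_count count_drop_vertex ?(N_uniq inp) //.
  have := dom y lty Ky; rewrite has_count.
  case: (boolP (x \in N y)) => xNy; last by rewrite subn0.
  have /(allP allN) : y \in N x by rewrite (N_sym inp).
  by rewrite (negPf Ky) addn0; lia.
- move=> b; rewrite ltnS leq_eqVlt /=.
  case/predU1P=> [->|ltb]; first by rewrite /drop_vertex /= eqxx andbF.
  move=> Kb /andP[Sb _]; case: (priv b ltb Kb Sb) => [[y [lty Ky uy]]|ub].
    by left; exists y; split=> // z zN /andP[Sz _]; apply: uy.
  by right=> z ltz Kz /andP[Sz _]; apply: ub.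
Qed.

End Greedy.

(** The first scan of the list computes [removable] in register 4, the second updates the counters
    after a drop. Register 3 exceeds the number of dominators by one, hence the comparison with
    3. *)
Definition greedy : prog :=
  for_vertices
    (Seq (Get 2 5 (Reg 1))
    (If (Eq (Reg 2) (Imm 0)) Skip
    (Seq (If (Lt (Reg 3) (Imm 3)) (Add 4 (Imm 0) (Imm 0)) (Add 4 (Imm 1) (Imm 0)))
    (Seq (for_neighbours 1
            (Seq (Get 8 6 (Reg 7))
                 (If (Lt (Reg 8) (Imm 2)) (Add 4 (Imm 0) (Imm 0)) Skip)))
    (If (Eq (Reg 4) (Imm 0)) Skip
    (Seq (Put 5 (Reg 1) (Imm 0))
    (Seq (Sub 3 (Reg 3) (Imm 1))
         (for_neighbours 1
            (Seq (Get 8 6 (Reg 7))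
            (Seq (Sub 8 (Reg 8) (Imm 1)) (Put 6 (Reg 7) (Reg 8)))))))))))).

Lemma wp_greedy (K : pred nat) s : input_ok s -> arrays s 7 =1 (fun=> 0) ->
  regs s 3 = (count K (iota 0 n)).+1 ->
  (forall z, z < n -> arrays s 5 z = K z) ->
  (forall z, z < n -> arrays s 6 z = deg z + 2 * K z) ->
  has K (iota 0 n) -> (forall y, y < n -> ~~ K y -> N y != [::]) ->
  wp greedy (fun _ s' => exists S, [/\ input_ok s', arrays s' 7 =1 (fun=> 0),
      greedy_inv K S n & forall z, z < n -> arrays s' 5 z = K z && S z])
    (2 + 17 * n + 12 * off n) s.
Proof.
move=> [s0 a0 a1] a7 s3 a5 a6 hasK domK.
pose frame s := [/\ arrays s 0 = off, arrays s 1 = nbr & arrays s 7 =1 fun=> 0].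
pose J x s := exists S, [/\ frame s,
  regs s 3 = (count (predI K S) (iota 0 n)).+1,
  forall z, z < n -> arrays s 5 z = K z && S z,
  forall z, z < n -> arrays s 6 z = count S (N z) + 2 * K z
  & greedy_inv K S x].
apply: (@wp_for_vertices _ 15 12 J) => //.
- exists predT; split=> //.
  + by rewrite s3; congr _.+1; apply: eq_count => z /=; rewrite andbT.
  + by move=> z /a5->; rewrite andbT.
  + split=> //.
    * by rewrite -has_count; apply: sub_has hasK => z /=; rewrite andbT.
    * by move=> y lty /(domK y lty); rewrite has_predT lt0n size_eq0.
- move=> x {hasK domK a0 a1 a5 a6 a7 s0 s3}s ltx s0 s1 [S [[a0 a1 a7] s3 a5 a6 inv]].
  have Sx := greedy_unprocessed inv.
  (* One share for each of the two scans of the neighbours of [x]. *)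
  have -> : 12 * deg x = 6 * deg x + 6 * deg x by lia.
  have [m def_m] : exists m, m = 6 * deg x by eexists.
  rewrite -def_m.
  wp_step; first lia; rewrite /=.
  wp_step; first lia; rewrite /= s1 a5 // Sx andbT.
    rewrite eqb0 => Kx; wp_step; first lia; split=> //; exists S; split=> //.
    exact: greedy_skip.
  rewrite eqb0 negbK => Kx.
  set s' := set_reg s 2 _.
  pose ok := 2 <= count (predI K S) (iota 0 n).
  apply: wp_seq; apply: (wp_budget (c := 2) (P := fun t => t = set_reg s' 4 ok)).
  - wp_step => //=; rewrite s3 ltnS => hok; wp_step => //=; try lia.
      by rewrite addn0 /ok leqNgt hok.
    by rewrite addn0 /ok leqNgt (negPf hok).
  - lia.
  move=> k1 _ le_k1 ->.
  pose J1 l t := [/\ frame t, regs t 0 = n, regs t 1 = x, regs t 3 = regs s 3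
    & [/\ arrays t 5 = arrays s 5, arrays t 6 = arrays s 6
      & regs t 4 = ok && all (fun y => 2 <= arrays s 6 y) l]].
  apply: wp_seq; apply: (@wp_for_neighbours 1 _ 3 J1 _ _ _ x) => //.
  - by move=> l t v i; rewrite !inE => /or3P[] /eqP->.
  - by move=> l t [[]].
  - by rewrite /J1 /= andbT.
  - move=> l1 y l2 t _ [[b0 b1 b7] t0 t1 t3 [b5 b6 t4]] t7.
    wp_step => //=; wp_step => //=; rewrite b6 t7 => h2; wp_step => //=; split=> //; split=> //; split=> //=;
      rewrite all_rcons ?t4 leqNgt ?h2 ?(negPf h2) /= ?andbF //.
  - lia.
  move=> k2 t le_k2 [[b0 b1 b7] t0 t1 t3 [b5 b6 t4]].
  have {}t4 : regs t 4 = removable K S x.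
    rewrite t4 /removable; congr (nat_of_bool (_ && _)); apply: eq_in_all => y yN.
    by rewrite a6 // (N_lt inp ltx yN).
  wp_step; first lia; rewrite /= t4 eqb0 ?negbK => hrem.
    wp_step; first lia; split=> //; exists S; split=> //; rewrite ?t3 ?b5 ?b6 //.
    exact: greedy_keep.
  wp_step; first lia; rewrite /=.
  wp_step; first lia; rewrite /=.
  set S' := drop_vertex S x.
  pose J2 (l : seq nat) t := [/\ frame t, regs t 0 = n, regs t 1 = x,
     regs t 3 = regs s 3 - 1 & 
    (forall z, z < n -> arrays t 5 z = K z && S' z) /\
    (forall z, z < n -> arrays t 6 z = arrays s 6 z - (z \in l))].
  apply: (@wp_for_neighbours 1 _ 3 J2 _ _ _ x) => //.
  - by move=> l u v i; rewrite !inE => /or3P[] /eqP->.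
  - by move=> l u [[]].
  - split=> //=; first by rewrite t3.
    split=> z ltz; last by rewrite b6 subn0.
    by rewrite /S' /drop_vertex /= t1 b5 a5 //; case: (z == x); rewrite ?andbF ?andbT.
  - move=> l1 y l2 u def_N [[c0 c1 c7] u0 u1 u3 [c5 c6]] u7.
    have := N_uniq inp ltx; rewrite def_N cat_uniq /= negb_or => /and3P[_ /andP[yl1 _] _].
    do 3 (wp_step => //=); split=> //; split=> //; split=> // z ltz.
    rewrite /= u7 mem_rcons inE; case: eqP => [->|_] /=; last exact: c6.
    by rewrite c6 ?(negPf yl1) ?subn0 // (N_lt inp ltx) // def_N mem_cat mem_head orbT.
  - lia.
  move=> k3 u le_k3 [[c0 c1 c7] u0 u1 u3 [c5 c6]]; split=> //.
  exists S'; split=> //.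
  + rewrite u3 s3; have -> : count (predI K S') (iota 0 n)
      = count (drop_vertex (predI K S) x) (iota 0 n).
      by apply: eq_count => z /=; rewrite andbA.
    rewrite count_drop_vertex ?iota_uniq ?mem_iota //= ?ltx; last by rewrite Kx.
    by case/andP: hrem; lia.
  + move=> z ltz; rewrite c6 // a6 // count_drop_vertex ?(N_uniq inp) //.
    rewrite (N_sym inp ltx ltz); case: (boolP (x \in N z)) => xz; last by rewrite !subn0.
    (* Subtraction is truncated, so the count must be positive: [x] itself contributes to it. *)
    have : has S (N z) by apply/hasP; exists x.
    by rewrite has_count; lia.
  + exact: greedy_drop.
- by move=> s' s'0 [S [[b0 b1 b7] _ b5 _ inv]]; exists S.
Qed.


(** * Breadth-first search along the crossing edges *)

Lemma leq_sumn_sub (f : nat -> nat) l1 l2 : uniq l1 -> {subset l1 <= l2} ->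
  sumn (map f l1) <= sumn (map f l2).
Proof.
elim: l1 l2 => //= x l1 IH l2 /andP[xl1 unq] sub.
have xl2 : x \in l2 by apply: sub; rewrite mem_head.
rewrite (perm_sumn (perm_map f (perm_to_rem xl2))) /= leq_add2l.
apply: IH => // y yl1; have : y \in l2 by apply: sub; rewrite inE yl1 orbT.
rewrite (perm_mem (perm_to_rem xl2)) inE => /predU1P[eq_yx|//].
by rewrite -eq_yx yl1 in xl1.
Qed.

Lemma off_sumn x : x <= n -> off x = sumn [seq deg y | y <- iota 0 x].
Proof.
elim: x => [|x IH] ltx; first exact: off0 inp.
by rewrite (offS inp) // IH 1?ltnW // -addn1 iotaD map_cat sumn_cat /= addn0.
Qed.

Section Search.

Variable B : pred nat.

Definition crosses x y := (y \in N x) && (B x != B y).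

(** Output edge i joins the queue entry at position i + 1 to its parent, which sits at an earlier
    position; the shift by one is due to the root, vertex 0, which has no parent. *)
Record search_tree (q : seq nat) (a2 a3 : nat -> nat) : Prop := SearchTree {
  search_uniq : uniq q;
  search_lt : forall y, y \in q -> y < n;
  search_size : 0 < size q;
  search_root : nth 0 q 0 = 0;
  search_parent : forall i, i.+1 < size q -> a3 i = nth 0 q i.+1 /\
    exists j, [/\ j <= i, a2 i = nth 0 q j & crosses (nth 0 q j) (nth 0 q i.+1)]
}.

Record search_state (q : seq nat) (s : state) : Prop := SearchState {
  search_input : input_ok s;
  search_tail : regs s 2 = size q;
  search_side : forall z, z < n -> arrays s 5 z = B z;
  search_seen : forall z, z < n -> arrays s 7 z = (z \in q);
  search_queue : forall i, i < size q -> arrays s 8 i = nth 0 q i;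
  search_output : search_tree q (arrays s 2) (arrays s 3)
}.

Definition bfs_visit : prog :=
  Seq (Get 8 5 (Reg 7))
  (If (Eq (Reg 8) (Reg 4)) Skip
  (Seq (Get 8 7 (Reg 7))
  (If (Eq (Reg 8) (Imm 0))
     (Seq (Put 7 (Reg 7) (Imm 1))
     (Seq (Put 8 (Reg 2) (Reg 7))
     (Seq (Sub 8 (Reg 2) (Imm 1))
     (Seq (Put 2 (Reg 8) (Reg 3))
     (Seq (Put 3 (Reg 8) (Reg 7))
          (Add 2 (Reg 2) (Imm 1)))))))
     Skip))).

Definition bfs : prog :=
  Seq (Put 7 (Imm 0) (Imm 1))
 (Seq (Put 8 (Imm 0) (Imm 0))
 (Seq (Add 1 (Imm 0) (Imm 0))
 (Seq (Add 2 (Imm 1) (Imm 0))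
      (While (Lt (Reg 1) (Reg 2))
        (Seq (Get 3 8 (Reg 1))
        (Seq (Add 1 (Reg 1) (Imm 1))
        (Seq (Get 4 5 (Reg 3))
             (for_neighbours 3 bfs_visit)))))))).

Lemma search_size_le q a2 a3 : search_tree q a2 a3 -> size q <= n.
Proof.
move=> tr; rewrite -(size_iota 0 n); apply: uniq_leq_size (search_uniq tr) _ => y yq.
by rewrite mem_iota (search_lt tr).
Qed.

Lemma wp_bfs_visit q s x y : x < n -> x \in q -> y \in N x ->
  search_state q s -> regs s 3 = x -> regs s 4 = B x -> regs s 7 = y ->
  wp bfs_visit (fun _ s' => exists r,
    [/\ search_state (q ++ r) s', B x != B y -> y \in q ++ r
      & forall i, i \in [:: 1; 3; 4; 5; 6] -> regs s' i = regs s i]) 10 s.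
Proof.
move=> ltx xq yN [[s0 a0 a1] s2 a5 a7 a8 tr] s3 s4 s7.
have lty := N_lt inp ltx yN.
wp_step => //=; wp_step => //=; rewrite s7 a5 // s4.
  move=> /eqP eqB; wp_step => //=; exists [::]; rewrite cats0; split=> //.
    by case: (B x) eqB; case: (B y).
  by move=> i; rewrite !inE => /or4P[/eqP->|/eqP->|/eqP->|/orP[]/eqP->].
move=> neB; have {}neB : B x != B y by move: neB; case: (B x); case: (B y).
wp_step => //=; wp_step => //=; rewrite s7 a7 // eqb0 => yq; last first.
  rewrite negbK in yq; wp_step => //=; exists [::]; rewrite cats0; split=> //.
  by move=> i; rewrite !inE => /or4P[/eqP->|/eqP->|/eqP->|/orP[]/eqP->].
have le_q := search_size_le tr.
do 5 (wp_step => //=); wp_step => //=; first by rewrite s2; lia.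
exists [:: y]; rewrite cats1 mem_rcons mem_head; split=> //; last first.
  by move=> i; rewrite !inE => /or4P[/eqP->|/eqP->|/eqP->|/orP[]/eqP->].
have [unq lt_q q0 root par] := tr.
split=> //=.
- by rewrite s2 size_rcons addn1.
- move=> z ltz; rewrite s7 mem_rcons inE.
  by case: eqP => //= _; rewrite a7.
- move=> i; rewrite size_rcons nth_rcons s2 s7 ltnS leq_eqVlt.
  case: ltngtP => //= lti _; exact: a8.
- split=> //.
  + by rewrite rcons_uniq yq.
  + by move=> z; rewrite mem_rcons inE => /predU1P[->|/lt_q].
  + by rewrite size_rcons.
  + by rewrite nth_rcons q0.
  + move=> i; rewrite size_rcons ltnS s2 s3 s7 leq_eqVlt !nth_rcons.
    case/predU1P=> [eq_i|lti].
      rewrite -eq_i subn1 /= ltnn !eqxx; split=> //.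
      exists (index x q); have ltxq : index x q < size q by rewrite index_mem.
      rewrite nth_rcons ltxq nth_index // /crosses yN neB; split=> //.
      by rewrite -ltnS eq_i.
    rewrite lti; have ne : (i == size q - 1) = false by apply/negbTE; rewrite neq_ltn ltn_subRL add1n lti.
    rewrite ne; have [-> [j [le_j -> cr]]] := par i lti; split=> //.
    exists j; rewrite !nth_rcons (leq_ltn_trans le_j (ltnW lti)); split=> //.
Qed.

Lemma wp_bfs s : input_ok s -> 0 < n -> arrays s 7 =1 (fun=> 0) ->
  (forall z, z < n -> arrays s 5 z = B z) ->
  wp bfs (fun _ s' => exists q, search_state q s' /\
     forall x y, x \in q -> crosses x y -> y \in q) (5 + 8 * n + 13 * off n) s.
Proof.
move=> [s0 a0 a1] n_gt0 a7 a5.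
have [m def_m] : exists m, m = 8 * n + 13 * off n by eexists.
rewrite -addnA -def_m.
do 3 (wp_step => //=).
wp_step => //=; first lia.
(* The first [h] entries of the queue are fully scanned. Each costs 8 for the test, three
   instructions and the overhead of [for_neighbours], and each neighbour costs 10 + 3. *)
pose J k t := exists q h, [/\ search_state q t, regs t 1 = h, h <= size q,
  forall x y, x \in take h q -> crosses x y -> y \in q &
  1 + 8 * n + 13 * off n <= k + (8 * h + 13 * sumn [seq deg y | y <- take h q])].
apply: (wp_while (J := J)).
  exists [:: 0], 0; rewrite take0 /= ?muln0 ?addn0; split=> //; last by rewrite def_m; lia.
  split=> //= [z ltz|[]//|]; first by rewrite inE; case: eqP => //= _; rewrite a7.
  by split=> // y; rewrite inE => /eqP->.
move=> k {a0 a1 a5 a7 s0 def_m m}s [q [h [st s1 le_h clos le_k]]].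
have [[s0 a0 a1] s2 a5 a7 a8 tr] := st.
have le_q := search_size_le tr.
(* Queue entries are distinct vertices, so the scanned degrees never exceed the sum of all degrees;
   this keeps the search linear. *)
have sum_le h' : sumn [seq deg y | y <- take h' q] <= off n.
  rewrite off_sumn //; apply: leq_sumn_sub; first exact: take_uniq (search_uniq tr).
  by move=> y /mem_take /(search_lt tr); rewrite mem_iota.
split; first by have := sum_le h; lia.
rewrite /= s1 s2; case: ltnP => [lt_h|ge_h]; last first.
  exists q; split=> // x y xq; apply: clos.
  by rewrite take_oversize.
pose x := nth 0 q h.
have xq : x \in q by apply: mem_nth.
have ltx := search_lt tr xq.
have takeS : take h.+1 q = rcons (take h q) x by rewrite (take_nth 0).
have := sum_le h.+1; rewrite takeS map_rcons sumn_rcons => sum_h.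
have k_big : 8 + 13 * deg x < k by lia.
wp_step; first lia; rewrite /= s1 a8 //.
wp_step; rewrite /=; [lia | rewrite s1; lia |].
wp_step; first lia; rewrite /= s1 addn1 a5 //.
pose J1 (l : seq nat) t := exists r, [/\ search_state (q ++ r) t, regs t 1 = h.+1, regs t 3 = x,
  regs t 4 = B x & forall y, y \in l -> B x != B y -> y \in q ++ r].
apply: (@wp_for_neighbours 3 _ 10 J1 _ _ _ x) => //.
- move=> l t v i i567 [r [[[]]]] *; exists r.
  by move: i567; rewrite !inE => /or3P[] /eqP->.
- by move=> l t [r [[[]]]].
- by exists [::]; rewrite cats0; split.
- move=> l1 y l2 t def_N [r [st_t t1 t3 t4 seen]] t7.
  have yN : y \in N x by rewrite def_N mem_cat mem_head orbT.
  have xqr : x \in q ++ r by rewrite mem_cat xq.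
  apply: wp_budget (wp_bfs_visit ltx xqr yN st_t t3 t4 t7) _ _ => //.
  move=> _ t' _ [r' [st_t' yqr same]]; split; try by rewrite same.
  exists (r ++ r'); rewrite catA; split; rewrite ?same // => z.
  rewrite mem_rcons inE => /predU1P[->//|zl1 neB].
  by rewrite mem_cat seen.
- lia.
move=> k' t le_k' [r [st_t t1 _ _ seen]].
have takeE : take h.+1 (q ++ r) = take h.+1 q by rewrite takel_cat.
exists (q ++ r), h.+1; rewrite takeE; split=> //.
- by rewrite size_cat; lia.
- rewrite takeS => u v; rewrite mem_rcons inE => /predU1P[->|uq cr].
    by case/andP=> vN neB; apply: seen.
  by rewrite mem_cat (clos u v).
- by rewrite takeS map_rcons sumn_rcons; lia.
Qed.

End Search.


(** * Composition of the phases *)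

Definition main : prog :=
  Seq count_degrees (Seq find_threshold (Seq init_dominators (Seq greedy (Seq bfs
    (If (Eq (Reg 2) (Reg 0)) (Add 0 (Imm 1) (Imm 0)) (Add 0 (Imm 0) (Imm 0))))))).

(** The bound is the sum of the five phase budgets plus 2 for the final test and assignment. *)
Lemma wp_main s : 2 < n -> input_ok s -> (forall a i, 1 < a -> arrays s a i = 0) ->
  (forall x, x < n -> N x != [::]) ->
  wp main (fun _ s' => exists t S q, let K v := t <= deg v in
    [/\ t <= (high t).+1 /\ high t.+1 < t, greedy_inv K S n,
      search_tree (predI K S) q (arrays s' 2) (arrays s' 3),
      forall x y, x \in q -> crosses (predI K S) x y -> y \in q
    & regs s' 0 = (size q == n)]) (16 + 48 * n + 25 * off n) s.
Proof.
move=> gt2 in0 zero nbrs; pose m := off n.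
have m_eq : off n = m by [].
apply: wp_seq; apply: wp_budget (wp_count_degrees in0 zero) _ _; first lia.
move=> k1 s1 le_k1 [in1 z1 cnt].
apply: wp_seq; apply: wp_budget (wp_find_threshold (ltnW gt2) in1 z1 cnt) _ _; first lia.
move=> k2 s2 le_k2 [t [in2 z2 r9 r3 [le_t lt_t]]].
apply: wp_seq; apply: wp_budget (wp_init_dominators in2 z2 r9) _ _; first lia.
move=> k3 s3 le_k3 [in3 z3 r3' a5 a6].
(* If no degree reached [t], then t <= 1, which vertex 0 attains because it has a neighbour. *)
have hasK : has (fun v => t <= deg v) (iota 0 n).
  rewrite has_count -/(high t) lt0n; apply/eqP=> high0.
  have t1 : t <= 1 by rewrite high0 in le_t.
  have : has (fun v => t <= deg v) (iota 0 n).
    apply/hasP; exists 0; first by rewrite mem_iota; lia.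
    apply: leq_trans t1 _; rewrite lt0n size_eq0; apply: nbrs; lia.
  by rewrite has_count -/(high t) high0.
have domK y : y < n -> ~~ (t <= deg y) -> N y != [::] by move=> /nbrs.
rewrite r3 in r3'.
apply: wp_seq; apply: wp_budget (wp_greedy in3 z3 r3' a5 a6 hasK domK) _ _; first lia.
move=> k4 s4 le_k4 [S [in4 z4 inv b5]].
have n0 : 0 < n by lia.
apply: wp_seq; apply: wp_budget (@wp_bfs (predI (fun v => t <= deg v) S) s4 in4 n0 z4 b5) _ _; first lia.
move=> k5 s5 le_k5 [q [[[c0 _ _] c2 _ _ _ tr] clos]].
wp_step; first lia; rewrite /= c0 c2 => hq; (wp_step; [lia | rewrite /=; lia |]);
  by exists t, S, q; split=> //=; rewrite ?hq ?(negPf hq).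
Qed.

End Phases.

(** * The algorithm *)

(** For n = 1 register 0 already holds the right answer 1; for n = 2 the only spanning tree is an
    edge, which is not even. *)
Definition even_tree_program : prog :=
  If (Lt (Reg 0) (Imm 3)) (If (Eq (Reg 0) (Imm 2)) (Add 0 (Imm 0) (Imm 0)) Skip) main.

(** * The input arrays as neighbour lists *)

Section Input.

Variables (n : nat) (e : rel 'I_n) (adj : 'I_n -> seq 'I_n).
Hypotheses (simple_e : simple_graph e) (adjE : adjacency_lists e adj).

Definition nbrs_of (x : nat) : seq nat :=
  if insub x is Some i then [seq val y | y <- adj i] else [::].

Lemma nbrs_of_ord (x : 'I_n) : nbrs_of x = [seq val y | y <- adj x].
Proof. by rewrite /nbrs_of valK. Qed.

Lemma mem_nbrs_of (x y : 'I_n) : (val y \in nbrs_of x) = e x y.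
Proof. by rewrite nbrs_of_ord (mem_map val_inj) (adjE x).2. Qed.

Lemma size_nbrs_of (x : 'I_n) : size (nbrs_of x) = #|[pred y | e x y]|.
Proof.
rewrite nbrs_of_ord size_map -(card_uniqP (adjE x).1).
by apply: eq_card => y; rewrite (adjE x).2.
Qed.

Let off := arrays (input_state adj) 0.

Lemma input_offset x : x <= n -> off x = size (flatten [seq nbrs_of y | y <- iota 0 x]).
Proof.
move=> lex; rewrite /off /= nth_mkseq ?ltnS //.
rewrite size_flatten /shape -map_comp sumnE big_map.
rewrite -{2}[x]subn0 -/(index_iota 0 x) big_mkord.
rewrite (big_ord_widen n (fun y => size (nbrs_of y))) //.
by apply: eq_bigr => y _; rewrite nbrs_of_ord size_map.
Qed.

Lemma input_neighbours : arrays (input_state adj) 1 =1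
  nth 0 (flatten [seq nbrs_of y | y <- iota 0 n]).
Proof.
move=> i /=; congr nth; rewrite map_flatten -map_comp -val_enum_ord -map_comp.
by congr flatten; apply: eq_map => y /=; rewrite nbrs_of_ord.
Qed.

Lemma input_graph : graph_input n nbrs_of off (arrays (input_state adj) 1).
Proof.
have offS x : x < n -> off x.+1 = off x + size (nbrs_of x).
  move=> ltx; rewrite (input_offset ltx) (input_offset (ltnW ltx)).
  have -> : iota 0 x.+1 = iota 0 x ++ [:: x] by rewrite -addn1 iotaD.
  by rewrite map_cat flatten_cat size_cat /= cats0.
have [e_sym e_irr] := simple_e.
split=> //.
- by rewrite input_offset.
- move=> x i ltx lti; rewrite input_neighbours input_offset 1?ltnW //.
  have -> : n = x + (n - x) by lia.
  rewrite iotaD map_cat flatten_cat nth_cat ltnNge leq_addr /= addKn add0n.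
  have -> : n - x = (n - x).-1.+1 by lia.
  by rewrite /= nth_cat lti.
- move=> x y ltx; rewrite (nbrs_of_ord (Ordinal ltx)) => /mapP[z _ ->].
  exact: ltn_ord.
- move=> x ltx; rewrite (nbrs_of_ord (Ordinal ltx)) (map_inj_uniq val_inj).
  exact: (adjE _).1.
- move=> x y ltx lty; have := mem_nbrs_of (Ordinal ltx) (Ordinal lty).
  by have := mem_nbrs_of (Ordinal lty) (Ordinal ltx) => /= -> ->; rewrite e_sym.
- move=> x ltx; have := mem_nbrs_of (Ordinal ltx) (Ordinal ltx).
  by rewrite /= => ->; rewrite e_irr.
Qed.

Lemma count_iota_ord (P : pred nat) :
  count P (iota 0 n) = #|[set x : 'I_n | P x]|.
Proof. by rewrite cardsE -val_enum_ord count_map enumT cardE /enum_mem size_filter. Qed.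

(** Handshake count: the adjacent ordered pairs are increasing or decreasing, and swapping
    coordinates matches the two kinds. *)
Lemma input_total : off n <= 2 * n_edges e.
Proof.
have [e_sym e_irr] := simple_e.
rewrite input_offset // size_flatten /shape -map_comp sumnE big_map.
have -> : iota 0 n = index_iota 0 n by rewrite /index_iota subn0.
rewrite big_mkord.
rewrite (eq_bigr (fun x : 'I_n => \sum_(y | e x y) 1)); last first.
  by move=> x _ /=; rewrite size_nbrs_of sum1_card.
rewrite pair_big_dep /= sum1_card mul2n -addnn.
pose lo := [pred xy : 'I_n * 'I_n | (xy.1 < xy.2) && e xy.1 xy.2].
pose hi := [pred xy : 'I_n * 'I_n | (xy.2 < xy.1) && e xy.1 xy.2].
have le_hi : #|hi| <= #|lo|.
  pose sw (xy : 'I_n * 'I_n) := (xy.2, xy.1).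
  rewrite -(card_image (f := sw) _ lo); last by move=> [x y] [z t] [-> ->].
  apply/subset_leq_card/subsetP=> -[x y] /andP[/= ltyx exy].
  by apply/imageP; exists (y, x); rewrite // inE /= ltyx e_sym.
apply: leq_trans (leq_add (leqnn #|lo|) le_hi).
rewrite -cardUI; apply: leq_trans (leq_addr _ _).
apply/subset_leq_card/subsetP=> -[x y]; rewrite !inE [in X in X -> _]unfold_in /= => exy.
rewrite exy !andbT -neq_ltn; apply: contraTneq exy => /val_inj->.
by rewrite e_irr.
Qed.

(** * Correctness of the answer and of the output tree *)

Section Output.

Variables (t : nat) (S : pred nat) (q : seq nat) (s : state).
Hypothesis gt2 : 2 < n.

Let K : pred nat := fun v => t <= size (nbrs_of v).
Let clique := [set x : 'I_n | K x].
Let dominators := [set x : 'I_n | predI K S x].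

Hypothesis inv : greedy_inv n nbrs_of K S n.
Hypothesis searched : search_tree n nbrs_of (predI K S) q (arrays s 2) (arrays s 3).

(** If [b] is the only dominator, any other vertex serves as its private vertex. *)
Lemma dominators_private b : b \in dominators ->
  exists2 i, i \notin dominators & {in dominators, forall z, e i z -> z = b}.
Proof.
rewrite inE /= => /andP[Kb Sb].
case: (greedy_private inv (ltn_ord b) Kb Sb) => [[y [lty Ky uy]]|ub].
  exists (Ordinal lty); first by rewrite inE /= (negPf Ky).
  move=> z; rewrite inE /= => /andP[_ Sz] eyz; apply/val_inj/uy => //.
  by rewrite -[y]/(val (Ordinal lty)) mem_nbrs_of.
have : 0 < #|[set~ b]| by rewrite cardsC1 card_ord; lia.
case/card_gt0P=> i; rewrite !inE => ib; exists i => [|z].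
  rewrite inE /=; apply: contra ib => /andP[Ki Si].
  by apply/eqP/val_inj/(ub _ (ltn_ord i)).
by rewrite inE => /andP[Kz Sz] _; apply/val_inj/(ub _ (ltn_ord z)).
Qed.

Lemma crosses_crossing (x y : 'I_n) :
  crosses nbrs_of (predI K S) x y = crossing e dominators x y.
Proof. by rewrite /crosses /crossing mem_nbrs_of !inE. Qed.

Section Spanning.

Hypothesis size_q : size q = n.

Let tree_q := @output_graph n s.

Lemma reached (x : 'I_n) : val x \in q.
Proof.
have [unq lt_q _ _ _] := searched.
have [] := uniq_min_size (s1 := q) (s2 := iota 0 n) unq.
- by move=> y /lt_q; rewrite mem_iota.
- by rewrite size_q size_iota.
by move=> _ /(_ x) ->; rewrite mem_iota /=.
Qed.

Let rank (x : 'I_n) := index (val x) q.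

Lemma rank_inj : injective rank.
Proof. by move=> x y /(congr1 (nth 0 q)); rewrite !nth_index ?reached // => /val_inj. Qed.

(** The second part says that a neighbour of smaller rank is the parent recorded for [x]; it
    provides the uniqueness required by [ranked_tree]. *)
Lemma output_edge x y : tree_q x y ->
  crossing e dominators x y /\ (rank y < rank x ->
    exists2 i, rank x = i.+1 & val y = arrays s 2 i).
Proof.
have [e_sym _] := simple_e; have [unq _ _ _ par] := searched.
case/existsP=> i; have lti : i.+1 < size q by rewrite size_q; have := ltn_ord i; lia.
have [a3 [j [le_j a2 cr]]] := par i lti; rewrite a3 a2; have ltj : j < size q by lia.
have rankE (z : 'I_n) k : k < size q -> nth 0 q k = z -> rank z = k.
  by move=> ltk eq_z; rewrite /rank -[val z]eq_z index_uniq.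
case/orP=> /andP[/eqP eq_u /eqP eq_v]; rewrite eq_u eq_v crosses_crossing in cr.
  by split=> //; rewrite (rankE _ _ ltj eq_u) (rankE _ _ lti eq_v); lia.
split; first by rewrite /crossing e_sym eq_sym.
by move=> _; exists i; rewrite ?(rankE _ _ lti eq_v) // a2 eq_u.
Qed.

Lemma output_up (x : 'I_n) : val x != 0 -> exists2 y, tree_q x y & rank y < rank x.
Proof.
have [unq lt_q q0 root par] := searched => x0.
have ltx : rank x < size q by rewrite index_mem reached.
have : nth 0 q (rank x) = x by rewrite nth_index ?reached.
case def_r : (rank x) => [|i]; first by rewrite root => eqx; rewrite -[val x]eqx in x0.
rewrite def_r in ltx => eqx; have [a3 [j [le_j a2 _]]] := par i ltx.
have ltj : j < size q by lia.
have lt_nth : nth 0 q j < n by apply: lt_q; rewrite mem_nth.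
exists (Ordinal lt_nth); last by rewrite /rank /= index_uniq.
have lti : i < n.-1 by rewrite size_q in ltx; lia.
apply/existsP; exists (Ordinal lti); rewrite /= a2 a3 eqx !eqxx /=.
by rewrite orbT.
Qed.

Lemma output_spanning_even_tree : spanning_even_tree e tree_q.
Proof.
have [e_sym e_irr] := simple_e.
have cross : subrel tree_q (crossing e dominators) by move=> x y /output_edge[].
have n0 : 0 < n by lia.
split; first by move=> x y /cross/andP[].
apply: (crossing_tree_even e_sym cross); last first.
- exact: dominators_private.
- by rewrite card_ord.
apply: (@ranked_tree _ _ rank (Ordinal n0)).
- split=> [x y|x].
    by apply: eq_existsb => i /=; rewrite orbC.
  by apply/idP=> txx; have /andP[] := cross _ _ txx; rewrite e_irr.
- exact: rank_inj.
- by move=> x x0; apply: output_up; apply: contra x0 => /eqP x0; apply/eqP/val_inj.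
- move=> x y z /output_edge[_ xy] /output_edge[_ xz] /xy[i eq_i eq_y] /xz[j eq_j eq_z].
  by apply: val_inj; rewrite eq_y eq_z; congr (arrays s 2 _); lia.
Qed.

End Spanning.

Section NotSpanning.

Hypothesis split_e : split_graph e.
Hypothesis threshold : t <= (high n nbrs_of t).+1 /\ high n nbrs_of t.+1 < t.
Hypothesis closed_q : forall x y, x \in q -> crosses nbrs_of (predI K S) x y -> y \in q.

Lemma high_card a : high n nbrs_of a = #|[set x : 'I_n | a <= #|[pred y | e x y]|]|.
Proof.
by rewrite /high count_iota_ord; apply: eq_card => x; rewrite !inE size_nbrs_of.
Qed.

Lemma clique_split : split_set e clique.
Proof.
have -> : clique = [set x : 'I_n | t <= #|[pred y | e x y]|].
  by apply/setP=> x; rewrite !inE /K size_nbrs_of.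
have [e_sym e_irr] := simple_e; have [le_t lt_t] := threshold.
by apply: degree_threshold_split; rewrite -?high_card.
Qed.

Lemma unreached_no_even_tree : size q != n -> ~ exists t, spanning_even_tree e t.
Proof.
move=> size_q; have [_ indK] := clique_split.
apply: (no_spanning_even_tree simple_e clique_split (B := dominators)).
- by rewrite card_ord; lia.
- by apply/subsetP=> x; rewrite !inE => /andP[].
- rewrite -card_gt0 -count_iota_ord; exact: greedy_nonempty inv.
- move=> i; rewrite inE => Ki.
  have /hasP[z zN Sz] := greedy_dominating inv (ltn_ord i) Ki.
  have ltz := N_lt input_graph (ltn_ord i) zN.
  have eiz : e i (Ordinal ltz) by rewrite -mem_nbrs_of.
  exists (Ordinal ltz) => //; rewrite inE /= Sz andbT; apply: contraLR eiz => Kz.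
  by apply: indK; rewrite !inE.
- exact: dominators_private.
have [unq lt_q q0 root _] := searched.
(* The queue has distinct entries below n, so a length other than n means that a vertex is missing.
   As the queue contains 0 and is closed under crossing edges, that vertex is not connected to 0. *)
have [y yq] : exists y : 'I_n, val y \notin q.
  apply/existsP; apply: contraR size_q => /existsPn allq.
  have sub : {subset iota 0 n <= q}.
    move=> y; rewrite mem_iota => /andP[_ lty]; have := allq (Ordinal lty).
    by rewrite negbK.
  rewrite eqn_leq (search_size_le searched).
  by have := uniq_leq_size (iota_uniq 0 n) sub; rewrite size_iota.
have n0 : 0 < n by lia.
exists (Ordinal n0), y; apply: contra yq => /connectP[p cp ->].
have : val (Ordinal n0) \in q by rewrite /= -{1}root mem_nth.
elim: p (Ordinal n0) cp => //= z p IH x /andP[cxz cp] xq.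
by apply: IH cp _; apply: closed_q xq _; rewrite crosses_crossing.
Qed.

End NotSpanning.

End Output.

End Input.

Theorem theorem10 :
  exists (p : prog) (c d : nat),
  forall (n : nat) (e : rel 'I_n) (adj : 'I_n -> seq 'I_n),
    simple_graph e -> connected_graph e -> split_graph e ->
    adjacency_lists e adj ->
    exists (time : nat) (s : state),
      [/\ exec (c * (n + n_edges e) ^ d) p (input_state adj) time s,
          time <= c * (n + n_edges e)
        & (answer s = 1 /\ spanning_even_tree e (@output_graph n s)) \/
          (answer s = 0 /\ ~ exists t : rel 'I_n, spanning_even_tree e t)].
Proof.
(* The cost is at most 17 + 48n + 25 * off n, where [off n] is at most twice the number of edges and
   n >= 1. With exponent 1 the same [W] bounds both the word size and the time. *)
exists even_tree_program, 100, 1 => n e adj simple_e conn_e split_e adjE; rewrite expn1.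
have n_gt0 : 0 < n by have := conn_e.1; rewrite card_ord.
have le_off := input_total simple_e adjE.
set W := 100 * _.
pose good s := (answer s = 1 /\ spanning_even_tree e (@output_graph n s)) \/
  (answer s = 0 /\ ~ exists t : rel 'I_n, spanning_even_tree e t).
suff : wp W even_tree_program (fun _ => good) W (input_state adj).
  by case=> [k [s []]]; exists k, s.
have W_big : W = 100 * (n + n_edges e) by [].
clearbody W; rewrite /even_tree_program.
wp_step; rewrite /=; first lia.
  move=> lt3; wp_step; rewrite /=; first lia.
    move=> /eqP n2; wp_step; rewrite /=; [lia | lia |].
    right; split=> // -[t [_]]; apply: no_even_tree_on_edge.
    by rewrite card_ord.
  move=> n_ne2; have n1 : n = 1 by lia.
  wp_step; rewrite /=; first lia.
  left; split=> //.
  (* Edges are indexed by ['I_n.-1], which is empty for n = 1. *)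
  have none x y : @output_graph n (input_state adj) x y = false.
    by apply/existsP=> -[[i lti] _]; lia.
  split=> [x y|]; first by rewrite none.
  apply: trivial_even_tree; first by rewrite card_ord.
  by split=> [x y|x]; rewrite !none.
rewrite -leqNgt => gt2.
have inp := input_graph simple_e adjE.
have nbrs x : x < n -> nbrs_of adj x != [::].
  move=> ltx; rewrite -size_eq0 -[x]/(val (Ordinal ltx)) (size_nbrs_of adjE) -lt0n.
  have gt1 : 1 < #|'I_n| by rewrite card_ord; lia.
  have [y exy] := connected_exists_neighbour (Ordinal ltx) conn_e gt1.
  by apply/card_gt0P; exists y.
apply: wp_budget (wp_main (W := _) inp _ gt2 _ _ nbrs) _ _.
- by lia.
- by [].
- by case=> [|[]].
- by lia.
move=> _ s _ [t [S [q [thr inv tr clos ans]]]]; rewrite /good /answer ans.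
case: eqP => [size_q|/eqP size_q]; [left | right]; split=> //.
  exact: (output_spanning_even_tree simple_e adjE gt2 inv tr size_q).
exact: (unreached_no_even_tree simple_e adjE gt2 inv tr split_e thr clos size_q).
Qed.
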